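(* Let $S$ be a finite set, $X^+=S^{\mathbb{Z}_+}$, and let $g:X^+\to[0,1]$ be a continuous $g$-function with $g>0$ which satisfies $$\sum_{n=1}^\infty \left(\operatorname{var}_n \log g\right)^2 \asymp \sum_{n=1}^\infty \left(\operatorname{var}_n g\right)^2<\infty .$$ Let $\mu$ be the corresponding unique $g$-measure. Then $K_g=\{\mu\}$; equivalently, there exists a unique $G$-measure, and it is the same as the unique $g$-measure.
   Context: $S$ is a finite set (the alphabet) with the discrete topology, $X^+=S^{\mathbb{Z}_+}$ with $\mathbb{Z}_+=\{0,1,2,\dots\}$ and the product topology, and $T:X^+\to X^+$ is the one-sided left shift $T(x_0,x_1,x_2,\ldots)=(x_1,x_2,\ldots)$. $\mathcal{P}X^+$ is the set of Borel probability measures on $X^+$. A $g$-function is a continuous function $g:X^+\to[0,1]$ with $\sum_{y\in T^{-1}x} g(y)=1$ for all $x\in X^+$. A $g$-measure associated to $g$ is a $T$-invariant measure $\mu\in\mathcal{P}X^+$ such that $g=d\mu/d(\mu\circ T)$, where $\mu\circ T$ is the measure $B\mapsto\sum_{s\in S}\mu(T(B\cap\{x: x_0=s\}))$. Under the hypotheses of the statement it is known that there is exactly one $g$-measure. For $f:X^+\to\mathbb{R}$, $\operatorname{var}_n f=\sup\{|f(x)-f(y)| : x,y\in X^+ \text{ coincide in the first } n \text{ coordinates}\}$. The symbol $\asymp$ means comparable up to positive multiplicative constants. The transfer operator acts on continuous $f:X^+\to\mathbb{R}$ by $\mathcal{L}f(x)=\sum_{y\in T^{-1}x} g(y)f(y)$.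 For $n\ge1$ put $P^{(n)}f(x)=(\mathcal{L}^n f)(T^n x)$, and let $P^{(n)\ast}:\mathcal{P}X^+\to\mathcal{P}X^+$ be the adjoint, defined by $\int f\,d(P^{(n)\ast}\nu)=\int P^{(n)}f\,d\nu$ for all continuous $f$. Set $K_g^n=\{\nu\in\mathcal{P}X^+ : P^{(n)\ast}\nu=\nu\}$ and $K_g=\bigcap_{n=1}^\infty K_g^n$. The elements of $K_g$ are called $G$-measures. *)

(* Defs.v *)
From HB Require Import structures.
From mathcomp Require Import all_boot all_order all_algebra.
From mathcomp Require Import all_classical all_reals all_analysis.
From mathcomp Require Import giry.

Set Implicit Arguments.
Unset Strict Implicit.
Unset Printing Implicit Defensive.

Import Order.TTheory GRing.Theory Num.Theory.
Import numFieldNormedType.Exports.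

Local Open Scope classical_set_scope.
Local Open Scope ring_scope.

(** Nonempty finite types: the library's measurable spaces are inhabited, and
    an empty alphabet carries no probability measure on its sequence space. *)
#[short(type="finPointedType")]
HB.structure Definition FinPointed := {S of Finite S & isPointed S}.

Definition seqspace (S : Type) : Type := nat -> S.

Section sequence_space.
Variable S : finPointedType.

Let top := prod_topology (fun _ : nat => discrete_topology S).

HB.instance Definition _ := Pointed.copy (seqspace S) top.
HB.instance Definition _ := Topological.copy (seqspace S) top.

Let borel := g_sigma_algebraType (@open (seqspace S)).

HB.instance Definition _ := Measurable.copy (seqspace S) borel.

End sequence_space.

Section shift.
Variable S : finPointedType.
Implicit Types (x y : seqspace S) (s : S).

Definition shift x : seqspace S := fun n => x n.+1.

Definition scons s x : seqspace S := fun n => if n is m.+1 then x m else s.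

Lemma shift_image_cylinder (B : set (seqspace S)) s :
  shift @` (B `&` [set x | x 0%N = s]) = scons s @^-1` B.
Proof.
have consK x : scons (x 0%N) (shift x) = x by apply/funext => -[].
apply/seteqP; split => [_ [x [Bx /= <-] <-]|x Bx].
  by rewrite /preimage /= consK.
by exists (scons s x).
Qed.

Lemma scons_continuous s : continuous (scons s : seqspace S -> seqspace S).
Proof.
move=> x.
have FF : Filter (nbhs (scons s @ x)).
  by apply: fmap_filter; exact: (@nbhs_filter (seqspace S)).
apply: (iffRL (@cvg_sup _ _ _ _ (scons s x) FF)) => i U [_ [[B oB <-] Bx] BU].
change (nbhs x (scons s @^-1` U)).
apply: (@filterS _ _ _ (scons s @^-1` (proj i @^-1` B))).
  by move=> y; exact: BU.
case: i B oB Bx {BU} => [|i] B oB Bx.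
  apply: (@filterS _ _ (@nbhs_filter (seqspace S) x) setT) => //.
  exact: filterT.
have := @proj_continuous nat (fun=> discrete_topology S) i x.
by apply; apply: open_nbhs_nbhs; split.
Qed.

Lemma measurable_scons s : measurable_fun setT (scons s).
Proof.
apply: (measurability (@open (seqspace S))) => // _ [B oB <-].
rewrite setTI; apply: sub_sigma_algebra.
by move/continuousP : (@scons_continuous s); exact.
Qed.

End shift.

(** The measure written mu \o T in the definition of g-measures. *)
Section comp_shift.
Local Open Scope ereal_scope.
Variables (R : realType) (S : finPointedType).
Variable mu : {measure set (seqspace S) -> \bar R}.

Definition comp_shift (B : set (seqspace S)) : \bar R :=
  \sum_(s : S) mu (@shift S @` (B `&` [set x | x 0%N = s])).

Let comp_shift_pushforward :
  comp_shift = fun B => \sum_(s : S) pushforward mu (scons s) B.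
Proof.
apply/funext => B; apply: eq_bigr => s _.
by rewrite shift_image_cylinder.
Qed.

Let comp_shift0 : comp_shift set0 = 0.
Proof.
by rewrite comp_shift_pushforward big1// => s _; rewrite /pushforward measure0.
Qed.

Let comp_shift_ge0 B : 0 <= comp_shift B.
Proof. by rewrite sume_ge0// => s _; exact: measure_ge0. Qed.

Let comp_shift_sigma_additive : semi_sigma_additive comp_shift.
Proof.
rewrite comp_shift_pushforward => F mF tF mUF.
rewrite [X in X @ _](_ : _ = fun n =>
    \sum_(s : S) \sum_(0 <= i < n) pushforward mu (scons s) (F i)); last first.
  by apply/funext => n; rewrite exchange_big.
apply: cvg_nnesum => [s _|s _].
  by apply: nearW => n; apply: sume_ge0 => i _; rewrite /pushforward measure_ge0.
have mscons B : measurable B -> measurable (scons s @^-1` B).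
  by move=> mB; rewrite -[X in measurable X]setTI; exact: measurable_scons.
rewrite /pushforward preimage_bigcup; apply: measure_semi_sigma_additive.
- by move=> n; exact: mscons.
- apply/trivIsetP => i j _ _ ij; rewrite -preimage_setI.
  by move/trivIsetP : tF => /(_ _ _ _ _ ij) ->//; rewrite preimage_set0.
- by rewrite -preimage_bigcup; exact: mscons.
Qed.

HB.instance Definition _ := isMeasure.Build _ _ _ comp_shift
  comp_shift0 comp_shift_ge0 comp_shift_sigma_additive.

End comp_shift.

Section g_functions.
Variables (R : realType) (S : finPointedType).
Implicit Types (f g : seqspace S -> R) (mu nu : probability (seqspace S) R).

(** Extended-real valued, so that no boundedness of [f] is presupposed. *)
Definition var (n : nat) f : \bar R :=
  ereal_sup [set `|f p.1 - f p.2|%:E | p in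
    [set p : seqspace S * seqspace S |
      forall i, (i < n)%N -> p.1 i = p.2 i]].

Definition sum_sqr_variation f : \bar R :=
  (\sum_(1 <= n <oo) var n f ^+ 2)%E.

Definition comparable_upto_const (a b : \bar R) : Prop :=
  exists c C : R,
    [/\ 0 < c, 0 < C, (c%:E * b <= a)%E & (a <= C%:E * b)%E].

Definition g_function g : Prop :=
  [/\ continuous g, forall x, 0 <= g x <= 1 &
      forall x, \sum_(y \in @shift S @^-1` [set x]) g y = 1].

Definition shift_invariant mu : Prop :=
  forall B, measurable B -> mu (@shift S @^-1` B) = mu B.

(** The second clause says that [g] is a density of [mu] with respect to
    [comp_shift mu]. *)
Definition g_measure g mu : Prop :=
  shift_invariant mu /\
  forall B, measurable B ->
    mu B = (\int[comp_shift mu]_(x in B) (g x)%:E)%E.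

Definition transfer g f : seqspace S -> R :=
  fun x => \sum_(y \in @shift S @^-1` [set x]) (g y * f y).

Definition Pn g (n : nat) f : seqspace S -> R :=
  fun x => iter n (transfer g) f (iter n (@shift S) x).

(** [adjoint_image P nu rho] means [P^* nu = rho]: the equation below, for all
    continuous [f], determines [rho] on Borel sets. *)
Definition adjoint_image (P : (seqspace S -> R) -> seqspace S -> R)
    nu (rho : probability (seqspace S) R) : Prop :=
  forall f, continuous f ->
    (\int[rho]_x (f x)%:E = \int[nu]_x (P f x)%:E)%E.

Definition Kgn g (n : nat) : set (probability (seqspace S) R) :=
  [set nu | adjoint_image (Pn g n) nu nu].

Definition Kg g : set (probability (seqspace S) R) :=
  \bigcap_(n in [set n | (1 <= n)%N]) Kgn g n.

End g_functions.

(* Main.v *)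
Require Import Defs.
From HB Require Import structures.
From mathcomp Require Import all_boot all_order all_algebra.
From mathcomp Require Import all_classical all_reals all_analysis.
From mathcomp Require Import giry.
From mathcomp Require Import measurable_realfun ring lra.
Import Order.TTheory GRing.Theory Num.Theory.
Import numFieldNormedType.Exports.
Local Open Scope classical_set_scope.
Local Open Scope ring_scope.

(** The value [L^n f x] is the mean of [f] over the random word of length [n]
    that [g] puts in front of [x].  For two starting points [x] and [y] that
    agree on their first [m] coordinates, the Hellinger affinity of the two word
    distributions is at least a product of factors [1 - O((var_k g)^2)], [k > m]:
    by square summability it is bounded below uniformly in [n], [x], [y], and it
    is close to 1 when [m] is large.  By Cauchy-Schwarz the same holds for the
    overlap (one minus the total variation distance).  Coupling block by block,
    two points that disagree produce a common block with probability at least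
    [b], and points sharing their last block lose it with probability at most
    [d], where [d] is arbitrarily small for long blocks while [b] is fixed.  Hence
    the oscillation of [L^n f] tends to 0, and since every G-measure satisfies
    [\int f = \int (L^n f) \o T^n], any two G-measures coincide. *)

(** * Cylinders, compactness and uniform continuity on the sequence space *)

Section sequence_space.
Set Implicit Arguments. Unset Strict Implicit.
Variable S : finPointedType.
Implicit Types (x y : seqspace S) (s : S) (n : nat).

Definition agree n x y := forall i, (i < n)%N -> x i = y i.

Lemma agreeS n m x y : (n <= m)%N -> agree m x y -> agree n x y.
Proof. by move=> nm xy i ni; apply: xy; exact: leq_trans nm. Qed.

Lemma agree_scons n s x y : agree n x y -> agree n.+1 (scons s x) (scons s y).
Proof. by move=> xy [|i]//= ni; exact: xy. Qed.

Lemma nbhs_agree n x : nbhs x [set y | agree n x y].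
Proof.
elim: n => [|n IH].
  by apply: (@filterS _ _ (@nbhs_filter (seqspace S) x) setT) => //; exact: filterT.
have h : nbhs x (@proj nat (fun=> discrete_topology S) n @^-1` [set x n]).
  apply: (@proj_continuous nat (fun=> discrete_topology S) n x).
  by apply: open_nbhs_nbhs; split => //; exact: discrete_open.
apply: filterS (@filterI _ _ (@nbhs_filter (seqspace S) x) _ _ IH h) => y [xy xny] i.
by rewrite ltnS leq_eqVlt => /orP[/eqP ->|]; [exact/esym/xny|exact: xy].
Qed.

(** The product topology is a supremum of topologies pulled back along coordinates, so it suffices
    that the filter generated by the cylinders at [x] converges to [x] in each coordinate. *)
Lemma nbhs_agreeP x (A : set (seqspace S)) :
  nbhs x A <-> exists n, forall y, agree n x y -> A y.
Proof.
split; last first.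
  by move=> [n h]; apply: (@filterS _ _ (@nbhs_filter (seqspace S) x)) (nbhs_agree n x).
move=> xA; suff: filter_from [set: nat] (fun n => [set y | agree n x y]) A.
  by move=> [n _ h]; exists n.
move: A xA; set F := filter_from _ _.
have FF : Filter F.
  apply: filter_from_filter; first by exists 0%N.
  move=> i j _ _; exists (maxn i j) => // y xy; split; apply: agreeS xy.
    exact: leq_maxl.
  exact: leq_maxr.
apply: (iffRL (@cvg_sup _ _ _ _ (x : prod_topology (fun _ : nat => discrete_topology S)) FF)).
move=> i U [_ [[B oB <-] Bx] BU]; exists i.+1 => // y xy.
by apply: BU; rewrite /= /proj -(xy i).
Qed.

Lemma continuous_agreeP (T : topologicalType) (h : seqspace S -> T) :
  continuous h <-> forall x A, nbhs (h x) A ->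
    exists n, forall y, agree n x y -> A (h y).
Proof.
split=> ch x A.
- by move=> /(ch x) /nbhs_agreeP.
- by move=> /(ch x) [n hn]; apply/nbhs_agreeP; exists n.
Qed.

Lemma shift_continuous : continuous (@Defs.shift S).
Proof.
apply/continuous_agreeP => x A /nbhs_agreeP[n hn]; exists n.+1 => y xy.
by apply: hn => i ni; exact: xy.
Qed.

Lemma compact_seqspace : compact [set: seqspace S].
Proof.
have := @tychonoff nat (fun=> discrete_topology S) (fun=> setT)
  (fun=> finite_compact (@finite_finset S setT : finite_set [set: discrete_topology S])).
by congr compact; rewrite eqEsubset.
Qed.

Lemma measurable_open (U : set (seqspace S)) : open U -> measurable U.
Proof. by move=> oU; exact: sub_sigma_algebra. Qed.

Lemma continuous_measurable (h : seqspace S -> seqspace S) :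
  continuous h -> measurable_fun setT h.
Proof.
move=> ch; apply: (measurability (@open (seqspace S))) => // _ [B oB <-].
by rewrite setTI; apply: measurable_open; move/continuousP: ch; exact.
Qed.

Variable R : realType.
Implicit Types f : seqspace S -> R.

Lemma measurable_fun_continuous f : continuous f -> measurable_fun setT f.
Proof.
move=> cf; apply: (measurability _ (RGenOpens.measurableE R)) => _ [_ [a [b ->]] <-].
rewrite setTI; apply: measurable_open.
by move/continuousP: cf; apply; exact: interval_open.
Qed.

Lemma measurable_EFin_continuous f : continuous f ->
  measurable_fun [set: seqspace S] (fun x => (f x)%:E).
Proof. by move=> cf; apply/measurable_EFinP; exact: measurable_fun_continuous. Qed.

Lemma continuous_has_min f : continuous f -> exists a, forall x, f a <= f x.
Proof.
move=> cf.
have [|a _ ha] := @compact_EVT_max _ R (fun x => - f x) setT (ex_intro _ point I) compact_seqspace.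
- by apply: continuous_subspaceT => x; exact: (continuousN (cf x)).
- by exists a => x; rewrite -lerN2 ha// inE.
Qed.

Lemma continuous_bounded f : continuous f -> exists M, forall x, `|f x| <= M.
Proof.
move=> cf.
have [|a _ ha] := @compact_EVT_max _ R (fun x => `|f x|) setT (ex_intro _ point I) compact_seqspace.
- by apply: continuous_subspaceT => x; exact: (cvg_norm (cf x)).
- by exists `|f a| => x; rewrite ha// inE.
Qed.

(** Otherwise, for each [n], a pair agreeing on [n] coordinates has values more than [e] apart; near
    a cluster point [z] of the first components, both values are within [e / 2] of [f z]. *)
Lemma unif_continuous_agree f (e : R) : continuous f -> 0 < e ->
  exists n, forall x y, agree n x y -> `|f x - f y| <= e.
Proof.
move=> cf e0; apply: contrapT => /forallNP h.
have {}h n : exists p : seqspace S * seqspace S,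
    agree n p.1 p.2 /\ e < `|f p.1 - f p.2|.
  have /existsNP[x /existsNP[y /not_implyP[xy hxy]]] := h n.
  by exists (x, y); split => //; rewrite ltNge; exact/negP.
have [p hp] := choice h.
have PF : ProperFilter ((fun n => (p n).1) @ \oo) by exact: fmap_proper_filter.
have [z [_ clz]] := compact_seqspace PF filterT.
have e20 : 0 < e / 2 by rewrite divr_gt0.
have [k hk] : exists n, forall y, agree n z y -> ball (f z) (e / 2) (f y).
  by apply/(iffLR (nbhs_agreeP z [set y | ball (f z) (e / 2) (f y)])); apply: cf; exact: nbhsx_ballx.
have Fk : ((fun n => (p n).1) @ \oo) [set (p n).1 | n in [set n | (k <= n)%N]].
  by exists k => // n kn; exists n.
have [_ [[n /= kn <-] zn]] := clz _ _ Fk (nbhs_agree k z).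
have [pn] := hp n; apply/negP; rewrite -leNgt.
have := hk _ zn; have : ball (f z) (e / 2) (f (p n).2).
  by apply: hk => i ik; rewrite -(pn i) ?zn//; exact: leq_trans ik kn.
rewrite /ball/= => h2 h1; rewrite (splitr e).
have -> : f (p n).1 - f (p n).2 = (f z - f (p n).2) - (f z - f (p n).1) by ring.
by rewrite (le_trans (ler_normB _ _))// lerD// ltW.
Qed.

End sequence_space.

(** * Inequalities for finite sums and products *)

Section real_sums.
Set Implicit Arguments. Unset Strict Implicit.
Variable R : realType.

(** Lagrange's identity: the double sum of squares is twice the difference of the two sides. *)
Lemma cauchy_schwarz_sum (I : Type) (r : seq I) (a b : I -> R) :
  (\sum_(i <- r) a i * b i) ^+ 2
    <= (\sum_(i <- r) a i ^+ 2) * (\sum_(i <- r) b i ^+ 2).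
Proof.
have : 0 <= \sum_(i <- r) \sum_(j <- r) (a i * b j - a j * b i) ^+ 2.
  by do 2!(apply: sumr_ge0 => ? _); exact: sqr_ge0.
under eq_bigr => i _.
  under eq_bigr => j _.
    have -> : (a i * b j - a j * b i) ^+ 2 =
      a i ^+ 2 * b j ^+ 2 + b i ^+ 2 * a j ^+ 2 - (a i * b i *+ 2) * (a j * b j).
      by ring.
    over.
  rewrite big_split big_split /= sumrN -!mulr_sumr; over.
rewrite big_split big_split /= sumrN -!mulr_suml sumrMnl.
set A := \sum_(i <- r) a i ^+ 2; set B := \sum_(i <- r) b i ^+ 2.
set C := \sum_(i <- r) _ => h; rewrite expr2; lra.
Qed.

(** A product of two numbers is that of their minimum and maximum, so Cauchy-Schwarz applies to the
    roots of these. *)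
Lemma sqr_sum_sqrt_le (I : Type) (r : seq I) (p q : I -> R) :
  (forall i, 0 <= p i) -> (forall i, 0 <= q i) ->
  (\sum_(i <- r) Num.sqrt (p i * q i)) ^+ 2
    <= (\sum_(i <- r) Num.min (p i) (q i)) *
       (\sum_(i <- r) Num.max (p i) (q i)).
Proof.
move=> p0 q0.
have -> : \sum_(i <- r) Num.sqrt (p i * q i) = \sum_(i <- r)
    Num.sqrt (Num.min (p i) (q i)) * Num.sqrt (Num.max (p i) (q i)).
  apply: eq_bigr => i _; rewrite -sqrtrM ?le_min ?p0 ?q0//.
  by case: leP => // _; rewrite mulrC.
apply: le_trans (cauchy_schwarz_sum _ _ _) _.
rewrite le_eqVlt; apply/orP; left; apply/eqP; congr (_ * _).
  by apply: eq_bigr => i _; rewrite sqr_sqrtr// le_min p0 q0.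
by apply: eq_bigr => i _; rewrite sqr_sqrtr// le_max p0.
Qed.

(** Weierstrass's product inequality; the induction uses that partial products stay in [0, 1]. *)
Lemma one_minus_sum_le_prod (a : nat -> R) n : (forall i, 0 <= a i <= 1) ->
  1 - \sum_(0 <= i < n) a i <= \prod_(0 <= i < n) (1 - a i).
Proof.
move=> a01; elim: n => [|n IH]; first by rewrite !big_nil subr0.
rewrite !big_nat_recr//=.
have P0 : 0 <= \prod_(0 <= i < n) (1 - a i) <= 1.
  elim: n {IH} => [|n IH]; first by rewrite big_nil lexx ler01.
  by rewrite big_nat_recr//=; have := a01 n; nra.
by have := a01 n; nra.
Qed.

(** The partial sum up to [m] is within [e] of the supremum of all partial sums; later blocks fit
    into the rest. *)
Lemma bounded_sum_small_tail (u : nat -> R) (M e : R) : (forall i, 0 <= u i) ->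
  (forall n, \sum_(0 <= i < n) u i <= M) -> 0 < e ->
  exists m, forall k n, (m <= k)%N -> \sum_(0 <= i < n) u (k + i)%N <= e.
Proof.
move=> u0 uM e0; pose U := range (fun n => \sum_(0 <= i < n) u i).
have sU : has_sup U.
  split; first by exists (\sum_(0 <= i < 0) u i); exists 0%N.
  by exists M => _ [n _ <-].
have [_ [m _ <-] hm] := sup_adherent e0 sU.
exists m => k n mk.
have split_at i j : \sum_(0 <= l < i + j) u l =
    \sum_(0 <= l < i) u l + \sum_(0 <= l < j) u (i + l)%N.
  elim: j => [|j IH]; first by rewrite addn0 big_nil addr0.
  by rewrite addnS !big_nat_recr//= IH addrA.
have umk : \sum_(0 <= i < m) u i <= \sum_(0 <= i < k) u i.
  by rewrite -(subnKC mk) split_at lerDl sumr_ge0.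
have : \sum_(0 <= i < k + n) u i <= sup U.
  by apply: sup_upper_bound => //; exists (k + n)%N.
rewrite split_at; move: hm umk; lra.
Qed.

End real_sums.

(** * Iterated transfer operators as averages over prepended words *)

Section transfer_words.
Set Implicit Arguments. Unset Strict Implicit.
Variables (R : realType) (S : finPointedType).
Implicit Types (x y : seqspace S) (s : S) (w : seq S) (f : seqspace S -> R).

Lemma fsum_shift_fiber (F : seqspace S -> R) x :
  \sum_(y \in @Defs.shift S @^-1` [set x]) F y = \sum_(s : S) F (scons s x).
Proof.
have -> : @Defs.shift S @^-1` [set x] = (fun s => scons s x) @` [set: S].
  apply/seteqP; split => [y <-|_ [s _ <-]//].
  by exists (y 0%N) => //; apply/funext => -[].
rewrite fsbig_image; last by move=> s t _ _ /(congr1 (fun z => z 0%N)).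
have -> : [set: S] = [set` index_enum S].
  by apply/seteqP; split => // s _ /=; exact: mem_index_enum.
by rewrite -fsbig_seq// index_enum_uniq.
Qed.

Variable g : seqspace S -> R.

Lemma transferE f x :
  transfer g f x = \sum_(s : S) g (scons s x) * f (scons s x).
Proof. exact: (fsum_shift_fiber (fun y => g y * f y)). Qed.

Fixpoint words n : seq (seq S) := if n is m.+1
  then [seq s :: w | s <- index_enum S, w <- words m] else [:: [::]].

(* The letters of [w] are put in front of [x] one after the other, so that the
   last letter of [w] ends up at coordinate 0. *)
Definition prepend w x : seqspace S := foldl (fun x s => scons s x) x w.

Fixpoint weight w x : R := if w is s :: w'
  then g (scons s x) * weight w' (scons s x) else 1.

Lemma size_words n w : w \in words n -> size w = n.
Proof.
elim: n w => [|n IH] w /=; first by rewrite inE => /eqP ->.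
by move=> /allpairsP[[s v] /= [_ /IH <- ->]].
Qed.

Lemma big_words (F : seq S -> R) n : \sum_(w <- words n.+1) F w =
  \sum_(s : S) \sum_(w <- words n) F (s :: w).
Proof. by rewrite /= big_allpairs_dep. Qed.

Lemma agree_prepend w n x y :
  agree n x y -> agree (size w + n) (prepend w x) (prepend w y).
Proof.
elim: w n x y => [//|s w IH] n x y xy.
by rewrite /= addSnnS; apply: IH; exact: agree_scons.
Qed.

Lemma iter_transferE n f x : iter n (transfer g) f x =
  \sum_(w <- words n) weight w x * f (prepend w x).
Proof.
elim: n x => [|n IH] x; first by rewrite big_seq1 mul1r.
rewrite iterS transferE big_words; apply: eq_bigr => s _.
by rewrite IH mulr_sumr; apply: eq_bigr => w _; rewrite /= mulrA.
Qed.

Lemma continuous_transfer f :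
  continuous g -> continuous f -> continuous (transfer g f).
Proof.
move=> cg cf.
have -> : transfer g f = fun x => \sum_(s : S) g (scons s x) * f (scons s x).
  by apply/funext => x; rewrite transferE.
apply: continuous_big => [|s _ x]; first exact: add_continuous.
have cs (h : seqspace S -> R) : continuous h -> {for x, continuous (h \o scons s)}.
  by move=> ch; apply: (@continuous_comp (seqspace S) (seqspace S) R); [exact: scons_continuous|exact: ch].
by apply: continuousM; exact: cs.
Qed.

Hypothesis g_pos : forall x, 0 < g x.
Hypothesis g_sum : forall x, \sum_(s : S) g (scons s x) = 1.

Lemma weight_ge0 w x : 0 <= weight w x.
Proof. by elim: w x => [|s w IH] x //=; rewrite mulr_ge0// ltW. Qed.

Lemma sum_weight n x : \sum_(w <- words n) weight w x = 1.
Proof.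
elim: n x => [|n IH] x; first by rewrite big_seq1.
rewrite big_words -(g_sum x); apply: eq_bigr => s _.
by rewrite -mulr_sumr IH mulr1.
Qed.

(* One minus the total variation distance of [weight^~ x] and [weight^~ y]. *)
Definition overlap n x y : R :=
  \sum_(w <- words n) Num.min (weight w x) (weight w y).

(* The Hellinger affinity of the same two distributions. *)
Definition affinity n x y : R :=
  \sum_(w <- words n) Num.sqrt (weight w x * weight w y).

Lemma overlapC n x y : overlap n x y = overlap n y x.
Proof. by apply: eq_bigr => w _; rewrite minC. Qed.

(** Minimum and maximum add up to the sum of the two weights, so the maxima total
    [2 - overlap n x y]. *)
Lemma sqr_affinity_le n x y :
  affinity n x y ^+ 2 <= overlap n x y * (2 - overlap n x y).
Proof.
apply: le_trans (sqr_sum_sqrt_le _ (weight_ge0^~ x) (weight_ge0^~ y)) _.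
rewrite le_eqVlt; apply/orP; left; apply/eqP; congr (_ * _).
apply/eqP; rewrite eq_sym subr_eq -big_split /=.
under eq_bigr do rewrite addr_max_min.
by rewrite big_split /= !sum_weight.
Qed.

(** Prepending one letter to both points lengthens their agreement by one, so successive letters
    contribute the factors [r m], [r m.+1], and so on. *)
Lemma affinity_ge (r : nat -> R) n m x y : (forall k, 0 <= r k) ->
  (forall k u v, agree k u v ->
     r k <= \sum_(s : S) Num.sqrt (g (scons s u) * g (scons s v))) ->
  agree m x y -> \prod_(0 <= i < n) r (m + i)%N <= affinity n x y.
Proof.
move=> r0 rg; elim: n m x y => [|n IH] m x y xy.
  by rewrite big_nil /affinity big_seq1 mulr1 sqrtr1.
rewrite big_nat_recl// addn0 /affinity big_words.
apply: (@le_trans _ _ (\sum_(s : S) Num.sqrt (g (scons s x) * g (scons s y)) *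
    \prod_(0 <= i < n) r (m.+1 + i)%N)).
  rewrite -mulr_suml.
  under eq_bigr do rewrite addnS -addSn.
  apply: ler_wpM2r; last exact: rg.
  by apply: prodr_ge0.
apply: ler_sum => s _ /=.
under [leRHS]eq_bigr do rewrite mulrACA sqrtrM ?mulr_ge0 ?ltW//.
rewrite -mulr_sumr; apply: ler_wpM2l; first exact: sqrtr_ge0.
by apply: IH; exact: agree_scons.
Qed.

(** The common part of the two word distributions uses the same word on both sides and costs at most
    [V]; the remaining mass costs at most [D]. *)
Lemma iter_transferB_le n f x y (V D c : R) :
  (forall u, c <= f u <= c + D) ->
  (forall w, w \in words n -> f (prepend w x) - f (prepend w y) <= V) ->
  iter n (transfer g) f x - iter n (transfer g) f y
    <= overlap n x y * V + (1 - overlap n x y) * D.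
Proof.
move=> fc fV.
have E z : iter n (transfer g) f z =
    c + \sum_(w <- words n) weight w z * (f (prepend w z) - c).
  rewrite iter_transferE; under [in RHS]eq_bigr do rewrite mulrBr.
  by rewrite big_split /= sumrN -mulr_suml sum_weight mul1r addrCA subrr addr0.
rewrite !E opprD addrACA subrr add0r -sumrB.
rewrite -[X in (X - _) * D](sum_weight n x) /overlap -sumrB !mulr_suml -big_split /=.
rewrite big_seq [leRHS]big_seq; apply: ler_sum => w ww.
move: (fc (prepend w x)) (fc (prepend w y)) (fV _ ww) (weight_ge0 w x) (weight_ge0 w y).
move: (weight w x) (weight w y) (f (prepend w x)) (f (prepend w y)) => p q F G.
move=> /andP[_ FD] /andP[cG _] FGV p0 q0.
(* Excess mass on the side of [x] costs at most [D]; on the side of [y] it only lowers the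
   difference, as [f - c] is nonnegative. *)
case: (leP p q) => h.
- have : 0 <= p * (V - (F - G)) by rewrite mulr_ge0// subr_ge0.
  have : 0 <= (q - p) * (G - c) by rewrite mulr_ge0// subr_ge0.
  rewrite subrr mul0r; lra.
- have : 0 <= q * (V - (F - G)) by rewrite mulr_ge0// subr_ge0.
  have : 0 <= (p - q) * (c + D - F) by rewrite mulr_ge0// subr_ge0// ltW.
  lra.
Qed.

End transfer_words.

(** With [s], [t] the roots of [p], [q], the left side is (s - t)^2, while p - q = (s - t)(s + t)
    and (s + t)^2 >= p >= m. *)
Lemma arith_geom_gap_le (R : realType) (m p q d : R) : 0 < m -> m <= p -> m <= q ->
  `|p - q| <= d -> p + q - 2 * Num.sqrt (p * q) <= d ^+ 2 / m.
Proof.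
move=> m0 mp mq pqd; have p0 := le_trans (ltW m0) mp; have q0 := le_trans (ltW m0) mq.
have pqd2 : (p - q) ^+ 2 <= d ^+ 2.
  by rewrite -(real_normK (num_real _)) lerXn2r ?nnegrE// (le_trans _ pqd).
rewrite ler_pdivlMr// sqrtrM//; apply: le_trans pqd2.
have := sqrtr_ge0 p; have := sqrtr_ge0 q.
rewrite -[in X in (X - _) ^+ 2](sqr_sqrtr p0) -[in X in (_ - X) ^+ 2](sqr_sqrtr q0).
rewrite -[in X in (X + _ - _)](sqr_sqrtr p0) -[in X in (_ + X - _)](sqr_sqrtr q0).
move: mp; rewrite -{1}(sqr_sqrtr p0).
move: (Num.sqrt p) (Num.sqrt q) => s t ms t0 s0.
have : (s - t) ^+ 2 * m <= (s - t) ^+ 2 * (s + t) ^+ 2.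
  by rewrite ler_wpM2l ?sqr_ge0// (le_trans ms)// lerXn2r ?nnegrE ?addr_ge0// lerDl.
by congr (_ <= _); ring.
Qed.

(** * Uniform lower bounds on affinity and overlap *)

Section contraction.
Set Implicit Arguments. Unset Strict Implicit.
Variables (R : realType) (S : finPointedType) (g : seqspace S -> R).
Implicit Types (x y : seqspace S) (f : seqspace S -> R).
Hypothesis g_pos : forall x, 0 < g x.
Hypothesis g_sum : forall x, \sum_(s : S) g (scons s x) = 1.
Hypothesis g_cont : continuous g.
Variables (v : nat -> R) (M : R).
Hypothesis v_var : forall k x y, agree k x y -> `|g x - g y| <= v k.
Hypothesis v_sum : forall n, \sum_(0 <= i < n) v i.+1 ^+ 2 <= M.

Lemma g_le1 x : g x <= 1.
Proof.
have -> : x = scons (x 0%N) (Defs.shift x) by apply/funext => -[].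
rewrite -(g_sum (Defs.shift x)) (bigD1 (x 0%N))//= lerDl.
by apply: sumr_ge0 => s _; exact: ltW.
Qed.

(* 1 - \sum_s sqrt (a_s b_s) is half of \sum_s (sqrt a_s - sqrt b_s)^2. *)
Lemma affinity1_ge : exists2 c : R, 0 < c <= 1 & exists2 K : R, 0 <= K &
  forall k x y, agree k x y ->
    1 - Num.min (1 - c) (K * v k.+1 ^+ 2) <=
      \sum_(s : S) Num.sqrt (g (scons s x) * g (scons s y)).
Proof.
have [a ga] := continuous_has_min g_cont.
(* One letter alone contributes at least the minimum [g a], which keeps the bound positive even
   where [K * v k.+1 ^+ 2] exceeds 1. *)
exists (g a); first by rewrite g_pos g_le1.
exists (#|S|%:R / g a); first by rewrite divr_ge0// ltW.
move=> k x y xy; rewrite lerBlDr -lerBlDl le_min; apply/andP; split.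
  rewrite lerB//.
  have ge0 s : 0 <= Num.sqrt (g (scons s x) * g (scons s y)) by exact: sqrtr_ge0.
  rewrite (bigD1 (point : S))//= -[leLHS]addr0 lerD ?sumr_ge0//.
  rewrite -[leLHS]gtr0_norm ?g_pos// -sqrtr_sqr ler_wsqrtr// expr2.
  by rewrite ler_pM// ltW.
have : \sum_(s : S) (g (scons s x) + g (scons s y)
    - 2 * Num.sqrt (g (scons s x) * g (scons s y))) <=
    \sum_(s : S) v k.+1 ^+ 2 / g a.
  apply: ler_sum => s _; apply: arith_geom_gap_le => //.
  by apply: v_var; exact: agree_scons.
rewrite big_split big_split /= sumrN -mulr_sumr !g_sum sumr_const -mulr_natl.
have : 0 <= #|S|%:R * (v k.+1 ^+ 2 / g a) :> R.
  by rewrite mulr_ge0// divr_ge0 ?sqr_ge0// ltW.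
rewrite mulrAC -mulrA; lra.
Qed.

(** The losses [a k] are summable, so tail products are close to 1 by Weierstrass's inequality. For
    the uniform bound, the first [m] factors are at least [c] each and the others have product at
    least 1/2. *)
Lemma affinity_bounds :
  (exists2 b : R, 0 < b & forall n x y, b <= affinity g n x y) /\
  (forall e : R, 0 < e -> exists m, forall k n x y, (m <= k)%N ->
    agree k x y -> 1 - e <= affinity g n x y).
Proof.
have [c /andP[c0 c1] [K K0 hK]] := affinity1_ge.
pose a k := Num.min (1 - c) (K * v k.+1 ^+ 2).
have a_ge0 k : 0 <= a k by rewrite le_min subr_ge0 c1 mulr_ge0 ?sqr_ge0.
have a_lec k : a k <= 1 - c by rewrite ge_min lexx.
have a01 k : 0 <= a k <= 1 by rewrite a_ge0 (le_trans (a_lec k))// gerBl ltW.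
have r_ge0 k : 0 <= 1 - a k by rewrite subr_ge0; case/andP: (a01 k).
have a_sum n : \sum_(0 <= i < n) a i <= K * M.
  apply: le_trans (ler_wpM2l K0 (v_sum n)); rewrite mulr_sumr.
  by apply: ler_sum => i _; rewrite ge_min lexx orbT.
have near1 e : 0 < e -> exists m, forall k n x y, (m <= k)%N ->
    agree k x y -> 1 - e <= affinity g n x y.
  move=> /(bounded_sum_small_tail a_ge0 a_sum)[m hm].
  exists m => k n x y mk xy.
  apply: le_trans (affinity_ge g_pos n r_ge0 hK xy).
  apply: le_trans (one_minus_sum_le_prod n (fun i => a01 (k + i)%N)).
  by rewrite lerB// hm.
split => //.
have [|m hm] := bounded_sum_small_tail a_ge0 a_sum (e := 2^-1); first by rewrite invr_gt0.
exists (c ^+ m / 2) => [|n x y]; first by rewrite divr_gt0// exprn_gt0.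
have xy : agree 0 x y by [].
apply: le_trans (affinity_ge g_pos n r_ge0 hK xy).
have c_le j : c ^+ j <= \prod_(0 <= i < j) (1 - a i).
  elim: j => [|j IH]; first by rewrite big_nil.
  rewrite big_nat_recr//= exprSr ler_pM ?exprn_ge0 ?(ltW c0)//.
  by rewrite lerBrDl -lerBrDr.
under eq_bigr do rewrite add0n.
have cm0 : 0 < c ^+ m by rewrite exprn_gt0.
have [nm|/ltnW/subnKC <-] := leqP n m.
  apply: le_trans (c_le n); apply: (@le_trans _ _ (c ^+ m)).
    by rewrite ler_pdivrMr// ler_peMr ?(ltW cm0)// ler1n.
  by rewrite ler_wiXn2l// ltW.
have -> j : \prod_(0 <= i < m + j) (1 - a i) =
    \prod_(0 <= i < m) (1 - a i) * \prod_(0 <= i < j) (1 - a (m + i)%N).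
  elim: j => [|j IH]; first by rewrite addn0 big_nil mulr1.
  by rewrite addnS !big_nat_recr//= IH mulrA.
rewrite ler_pM ?(ltW cm0)//.
apply: le_trans (one_minus_sum_le_prod _ (fun i => a01 (m + i)%N)).
have := hm m (n - m)%N (leqnn m); lra.
Qed.

(** Both bounds pass from affinity to overlap through [sqr_affinity_le], where o (2 - o) = 1 - (1 -
    o)^2. *)
Lemma overlap_bounds :
  (exists2 b : R, 0 < b <= 2^-1 & forall n x y, b <= overlap g n x y) /\
  (forall d : R, 0 < d -> exists m, forall n x y,
    agree m x y -> 1 - d <= overlap g n x y).
Proof.
have [[b b0 hb] near1] := affinity_bounds.
have o0 n x y : 0 <= overlap g n x y.
  by apply: sumr_ge0 => w _; rewrite le_min !weight_ge0.
have A0 n x y : 0 <= affinity g n x y by apply: sumr_ge0 => w _; exact: sqrtr_ge0.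
split.
  (* The division by 2 comes from 2 - o <= 2; the cap at 1/2 later keeps 1 - b - d nonnegative. *)
  exists (Num.min (b ^+ 2 / 2) 2^-1).
    by rewrite lt_min divr_gt0 ?exprn_gt0// invr_gt0 ltr0n ge_min lexx orbT.
  move=> n x y; rewrite ge_min; apply/orP; left.
  have : b ^+ 2 <= affinity g n x y ^+ 2 by rewrite lerXn2r ?nnegrE// ltW.
  have := sqr_affinity_le g_pos g_sum n x y; have := o0 n x y; nra.
(* This [e] gives (1 - e)^2 >= 1 - 2 e >= 1 - d^2; the cap at 1 makes 1 - e nonnegative for
   squaring. *)
move=> d d0; have e0 : 0 < Num.min 1 (d ^+ 2 / 2).
  by rewrite lt_min ltr01 divr_gt0// exprn_gt0.
have [m hm] := near1 _ e0; exists m => n x y xy.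
have := hm m n x y (leqnn m) xy.
set e := Num.min _ _ => eA.
have e1 : 0 <= 1 - e by rewrite subr_ge0 ge_min lexx.
have ed : e <= d ^+ 2 / 2 by rewrite ge_min lexx orbT.
have : (1 - e) ^+ 2 <= affinity g n x y ^+ 2 by rewrite lerXn2r ?nnegrE.
have := sqr_affinity_le g_pos g_sum n x y.
move: (overlap g n x y) => o h1 h2.
have : (1 - o) ^+ 2 <= d ^+ 2 by have := sqr_ge0 e; nra.
rewrite lerBlDr -lerBlDl => h.
rewrite leNgt; apply/negP => h'; nra.
Qed.

End contraction.

(** * Decay of the oscillation under iterated transfer *)

Section oscillation.
Set Implicit Arguments. Unset Strict Implicit.
Variables (R : realType) (S : finPointedType) (g : seqspace S -> R).
Implicit Types (x y : seqspace S) (f : seqspace S -> R).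
Hypothesis g_pos : forall x, 0 < g x.
Hypothesis g_sum : forall x, \sum_(s : S) g (scons s x) = 1.
Hypothesis g_cont : continuous g.

Lemma continuous_iter_transfer n f :
  continuous f -> continuous (iter n (transfer g) f).
Proof. by move=> cf; elim: n => [//|n]; exact: continuous_transfer. Qed.

(** As [V <= O], the coupling bound decreases in the overlap, which may be replaced by its lower
    bound [b]. *)
Lemma iter_transfer_dist_le n f x y (O V b : R) : continuous f ->
  (forall u v, `|f u - f v| <= O) ->
  (forall w, w \in words S n -> `|f (prepend w x) - f (prepend w y)| <= V) ->
  V <= O -> b <= overlap g n x y ->
  `|iter n (transfer g) f x - iter n (transfer g) f y| <= b * V + (1 - b) * O.
Proof.
move=> cf fO fV VO bo; have [a fa] := continuous_has_min cf.
have fc u : f a <= f u <= f a + O.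
  by rewrite fa -lerBlDl (le_trans (ler_norm _)).
apply: (@le_trans _ _ (overlap g n x y * V + (1 - overlap g n x y) * O)); last first.
  by nra.
rewrite ler_norml; apply/andP; split.
  rewrite lerNl opprB overlapC; apply: iter_transferB_le fc _ => // w /fV.
  by rewrite distrC; exact: le_trans (ler_norm _).
by apply: iter_transferB_le fc _ => // w /fV; exact: le_trans (ler_norm _).
Qed.

Variables (v : nat -> R) (M : R).
Hypothesis v_var : forall k x y, agree k x y -> `|g x - g y| <= v k.
Hypothesis v_sum : forall n, \sum_(0 <= i < n) v i.+1 ^+ 2 <= M.

(* In blocks of length [n], the pair (oscillation, oscillation on n-cylinders)
   is dominated by the iterates of the stochastic matrix
   [[1 - b, b], [d, 1 - d]], which converge to its stationary average
   [A = (d D + b V) / (b + d)]. *)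
Lemma iter_transfer_oscillation f (e : R) : continuous f -> 0 < e ->
  exists n, forall x y, `|iter n (transfer g) f x - iter n (transfer g) f y| <= e.
Proof.
move=> cf e0; have [B fB] := continuous_bounded cf.
have B0 : 0 <= B := le_trans (normr_ge0 _) (fB point).
have [[b /andP[b0 b2] hb] near1] := overlap_bounds g_pos g_sum g_cont v_var v_sum.
(* The final bound is 3 V; [D] dominates both [V] and the oscillation of [f]. *)
pose V := e / 3; pose D := 2 * B + e.
have V0 : 0 < V by rewrite divr_gt0.
have VD : V <= D by rewrite /V /D; lra.
have D0 : 0 < D by exact: lt_le_trans VD.
(* The ratio yields d D <= b V, hence A <= 2 V; the cap at 1/2 yields l >= 0. *)
pose d := Num.min 2^-1 (b * V / D).
have d0 : 0 < d by rewrite lt_min invr_gt0 ltr0n divr_gt0// mulr_gt0.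
have d2 : d <= 2^-1 by rewrite ge_min lexx.
have dV : d * D <= b * V by rewrite -ler_pdivlMr// ge_min lexx orbT.
have [n1 hn1] := near1 _ d0; have [n2 hn2] := unif_continuous_agree cf V0.
pose n := maxn n1 n2.
have bd : 0 < b + d by rewrite addr_gt0.
(* [l] is the second eigenvalue, with eigenvector (b, -d); [E] is scaled so that the bounds start at
   [D] and [V]. *)
pose A := (d * D + b * V) / (b + d); pose l := 1 - b - d.
pose E j := l ^+ j * ((D - V) / (b + d)).
have l0 : 0 <= l by rewrite /l; lra.
have E_ge0 j : 0 <= E j by rewrite mulr_ge0 ?exprn_ge0// divr_ge0 ?subr_ge0// ltW.
have inv j : (forall x y, `|iter (n * j) (transfer g) f x - iter (n * j) (transfer g) f y|
      <= A + b * E j) /\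
    (forall x y, agree n x y ->
      `|iter (n * j) (transfer g) f x - iter (n * j) (transfer g) f y| <= A - d * E j).
  elim: j => [|j [IHO IHV]].
    rewrite muln0 /E expr0 mul1r /=; split => [x y|x y xy].
      have -> : A + b * ((D - V) / (b + d)) = D by rewrite /A; field; rewrite gt_eqF.
      have := ler_normB (f x) (f y); have := fB x; have := fB y; rewrite /D; lra.
    have -> : A - d * ((D - V) / (b + d)) = V by rewrite /A; field; rewrite gt_eqF.
    by apply: hn2; apply: agreeS xy; exact: leq_maxr.
  have ES : E j.+1 = l * E j by rewrite /E exprS mulrA.
  have VO : A - d * E j <= A + b * E j by have := E_ge0 j; nra.
  rewrite mulnS !ES; split => [x y|x y xy].
    rewrite !iterD.
    apply: le_trans (iter_transfer_dist_le _ IHO _ VO (hb n x y)) _.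
    - exact: continuous_iter_transfer.
    (* A common word of length [n] makes any two points agree on [n] coordinates, so the cylinder
       bound applies. *)
    - move=> w /size_words wn; apply: IHV.
      have xy : agree 0 x y by [].
      by have := agree_prepend (w := w) xy; rewrite wn addn0.
    - by rewrite /l; nra.
  rewrite !iterD.
  apply: le_trans (iter_transfer_dist_le _ IHO _ VO (hn1 n x y _)) _.
  - exact: continuous_iter_transfer.
  - move=> w /size_words wn; apply: IHV.
    by apply: agreeS (agree_prepend (w := w) xy); rewrite wn leq_addr.
  - by apply: agreeS xy; exact: leq_maxl.
  - by rewrite /l; nra.
have [j hj] : exists j, l ^+ j * D <= V.
  have : l ^+ j @[j --> \oo] --> (0 : R).
    by apply: cvg_expr; rewrite ger0_norm// /l; lra.
  move/cvgrPdist_le => /(_ (V / D)); rewrite divr_gt0// => /(_ isT)[j _ /(_ j (leqnn j))].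
  rewrite /= sub0r normrN ger0_norm ?exprn_ge0// ler_pdivlMr// => hj.
  by exists j.
exists (n * j)%N => x y; apply: le_trans ((inv j).1 x y) _.
have -> : A + b * E j = (d * D + b * V + b * (l ^+ j * (D - V))) / (b + d).
  by rewrite /A /E; field; rewrite gt_eqF.
rewrite ler_pdivrMr//.
have lV : l ^+ j * (D - V) <= V.
  by apply: le_trans hj; rewrite ler_wpM2l ?exprn_ge0// gerBl ltW.
have -> : e = 3 * V by rewrite /V; field.
nra.
Qed.

End oscillation.

(** * Integration against a g-measure *)

Section g_measures.
Set Implicit Arguments. Unset Strict Implicit.
Local Open Scope ereal_scope.
Variables (R : realType) (S : finPointedType) (mu : probability (seqspace S) R).
Implicit Types (x y : seqspace S).

(** [comp_shift mu] is the sum of the pushforwards of [mu] by the maps [scons s]; letters are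
    numbered by their place in the enumeration to suit [msum]. *)
Lemma ge0_integral_comp_shift (h : seqspace S -> \bar R) :
  measurable_fun [set: seqspace S] h -> (forall x, 0 <= h x) ->
  \int[comp_shift mu]_x h x = \sum_(s : S) \int[mu]_x h (scons s x).
Proof.
move=> mh h0.
have ms (s : S) : measurable_fun [set: seqspace S] (scons s) := @measurable_scons S s.
pose pushes (n : nat) : {measure set (seqspace S) -> \bar R} :=
  pushforward mu (scons (nth point (index_enum S) n)).
pose m := pushes (fun n => ms _).
have big_nth_enum (F : S -> \bar R) :
    \sum_(s : S) F s = \sum_(n < size (index_enum S)) F (nth point (index_enum S) n).
  by rewrite (big_nth point) big_mkord.
rewrite big_nth_enum.
transitivity (\int[msum m (size (index_enum S))]_x h x).
  apply: eq_measure_integral => B mB _.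
  change (\sum_(s : S) mu (@Defs.shift S @` (B `&` [set x | x 0%N = s])) =
    \sum_(n < size (index_enum S)) m n B).
  rewrite big_nth_enum; apply: eq_bigr => i _.
  by rewrite shift_image_cylinder.
rewrite ge0_integral_measure_sum//; apply: eq_bigr => i _.
by rewrite ge0_integral_pushforward.
Qed.

Variable g : seqspace S -> R.
Hypothesis g_cont : continuous g.
Hypothesis g_ge0 : forall x, (0 <= g x)%R.
Hypothesis mu_density : forall B, measurable B ->
  mu B = \int[comp_shift mu]_(x in B) (g x)%:E.

(** The change of variables holds with the Radon-Nikodym derivative, which is [g] almost everywhere
    since both have the same integral on every measurable set. *)
Lemma ge0_integral_density (h : seqspace S -> \bar R) :
  measurable_fun [set: seqspace S] h -> (forall x, 0 <= h x) ->
  \int[mu]_x h x = \int[comp_shift mu]_x (h x * (g x)%:E).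
Proof.
move=> mh h0.
have kfin : fin_num_fun (comp_shift mu).
  move=> B mB; apply/sum_fin_numP => s _ _; rewrite shift_image_cylinder.
  apply: fin_num_measure; rewrite -[X in measurable X]setTI.
  exact: (@measurable_scons S s).
pose k : {finite_measure set (seqspace S) -> \bar R} :=
  HB.pack (comp_shift mu) (Measure_isFinite.Build _ _ _ (comp_shift mu) kfin).
have mg : measurable_fun [set: seqspace S] (fun x => (g x)%:E).
  exact: measurable_EFin_continuous.
have muk : mu `<< k.
  apply/null_content_dominatesP => B mB kB; rewrite [LHS]mu_density//.
  by apply: null_set_integral => //; exact: measurable_funTS.
rewrite -(Radon_Nikodym_SigmaFinite.change_of_variables muk h0 measurableT mh).
have fi := Radon_Nikodym_SigmaFinite.f_integrable muk.
apply: (@ae_eq_integral _ _ _ k) => //.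
- by apply: emeasurable_funM => //; exact: measurable_int fi.
- exact: emeasurable_funM.
apply: ae_eqe_mul2l; apply: integral_ae_eq => // B _ mB.
by rewrite -Radon_Nikodym_SigmaFinite.f_integral//; exact: mu_density.
Qed.

(** The integral of [f * g] against [comp_shift mu] is computed in two ways: by the density, and
    letter by letter. *)
Lemma ge0_integral_transfer (f : seqspace S -> R) : continuous f -> (forall x, (0 <= f x)%R) ->
  \int[mu]_x (transfer g f x)%:E = \int[mu]_x (f x)%:E.
Proof.
move=> cf f0.
have mgf : measurable_fun [set: seqspace S] (fun x => (f x * g x)%:E).
  apply: measurable_EFin_continuous => x.
  by apply: continuousM; [exact: cf|exact: g_cont].
have mf : measurable_fun [set: seqspace S] (fun x => (f x)%:E).
  exact: measurable_EFin_continuous.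
rewrite [RHS](ge0_integral_density mf)//.
rewrite [RHS](eq_integral (fun x => (f x * g x)%:E))//.
rewrite ge0_integral_comp_shift => [|//|x]; last by rewrite lee_fin mulr_ge0.
rewrite -ge0_integral_sum//.
- by apply: eq_integral => x _; rewrite transferE sumEFin; congr EFin;
    apply: eq_bigr => s _; rewrite mulrC.
- by move=> s; exact: (measurableT_comp mgf (@measurable_scons S s)).
- by move=> s x _; rewrite lee_fin mulr_ge0.
Qed.

Lemma ge0_integral_iter_transfer n (f : seqspace S -> R) :
  continuous f -> (forall x, (0 <= f x)%R) ->
  \int[mu]_x (iter n (transfer g) f x)%:E = \int[mu]_x (f x)%:E.
Proof.
move=> cf f0; elim: n => [//|n IH].
rewrite iterS ge0_integral_transfer//; first exact: continuous_iter_transfer.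
by elim: n {IH} => [//|n IH] x; rewrite iterS transferE sumr_ge0// => s _; rewrite mulr_ge0.
Qed.

End g_measures.

(** * Every g-measure is a G-measure *)

Section G_measures.
Set Implicit Arguments. Unset Strict Implicit.
Local Open Scope ereal_scope.
Variables (R : realType) (S : finPointedType).
Implicit Types (x y : seqspace S) (mu nu : probability (seqspace S) R).

Lemma integrable_continuous nu (f : seqspace S -> R) : continuous f ->
  nu.-integrable [set: seqspace S] (fun x => (f x)%:E).
Proof.
move=> cf; apply: measurable_bounded_integrable => //.
- by apply: (@le_lt_trans _ _ 1); [exact: probability_le1|exact: ltry].
- exact: measurable_fun_continuous.
- have [B fB] := continuous_bounded cf.
  exists B; split; first exact: num_real.
  by move=> M BM x _ /=; rewrite (le_trans (fB x))// ltW.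
Qed.

Lemma integral_continuousD_cst nu (f : seqspace S -> R) (c : R) : continuous f ->
  \int[nu]_x (f x + c)%:E = \int[nu]_x (f x)%:E + c%:E.
Proof.
move=> cf.
have cc : continuous ((fun=> c) : seqspace S -> R).
  by move=> x; exact: cst_continuous.
transitivity (\int[nu]_x ((f x)%:E + (cst c%:E) x)).
  by apply: eq_integral => x _; rewrite EFinD.
rewrite integralD//; [|exact: integrable_continuous|exact: integrable_continuous].
by congr (_ + _); rewrite integral_cst// -[RHS]mule1; congr (_ * _); exact: probability_setT.
Qed.

Lemma continuous_iter_shift n : continuous (iter n (@Defs.shift S)).
Proof.
elim: n => [|n IH] x; first exact.
apply: (@continuous_comp (seqspace S) (seqspace S) (seqspace S)); first exact: IH.
exact: shift_continuous.
Qed.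

Lemma measurable_iter_shift n : measurable_fun [set: seqspace S] (iter n (@Defs.shift S)).
Proof.
by apply: continuous_measurable; exact: continuous_iter_shift.
Qed.

Lemma integral_iter_shift mu n (h : seqspace S -> \bar R) : shift_invariant mu ->
  measurable_fun [set: seqspace S] h -> (forall x, 0 <= h x) ->
  \int[mu]_x h (iter n (@Defs.shift S) x) = \int[mu]_x h x.
Proof.
move=> inv mh h0.
have ms := continuous_measurable (@shift_continuous S).
elim: n => [//|n IH]; rewrite -IH.
under eq_integral do rewrite iterSr.
pose k x := h (iter n (@Defs.shift S) x).
have mk : measurable_fun [set: seqspace S] k.
  exact: measurableT_comp mh (measurable_iter_shift n).
have k0 : {in [set: seqspace S], forall y, 0 <= k y} by move=> y _; exact: h0.
rewrite -(ge0_integral_pushforward ms mu measurableT mk k0).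
by apply: eq_measure_integral => B mB _; exact: inv.
Qed.

(** Invariance removes the iterated shift, then the density removes the iterated transfer. Both
    facts concern nonnegative functions, so [f] is first raised by a bound [B] of its absolute
    value. *)
Lemma g_measure_Kg (g : seqspace S -> R) mu : continuous g ->
  (forall x, (0 < g x)%R) -> (forall x, \sum_(s : S) g (scons s x) = 1)%R ->
  g_measure g mu -> Kg g mu.
Proof.
move=> cg g0 g1 [inv dens] n _ f cf.
have [B fB] := continuous_bounded cf.
have cfB : continuous (fun x => f x + B)%R.
  by move=> x; apply: continuousD; [exact: cf|exact: cst_continuous].
have fB0 x : (0 <= f x + B)%R.
  by have := ler_norm (- f x); rewrite normrN; have := fB x; lra.
have cLf h : continuous h -> continuous (iter n (transfer g) h).
  exact: continuous_iter_transfer.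
have cst_eq (a b : \bar R) : a + B%:E = b + B%:E -> a = b.
  by move/(congr1 (fun z => z - B%:E)); rewrite !addeK.
apply: cst_eq; rewrite -!integral_continuousD_cst//; last first.
  by move=> x; apply: continuous_comp; [exact: continuous_iter_shift|exact: cLf].
(* The weights sum to 1, so adding a constant commutes with [Pn]. *)
have PnD x : (Pn g n f x + B = iter n (transfer g) (fun y => f y + B) (iter n (@Defs.shift S) x))%R.
  rewrite /Pn !iter_transferE; under [RHS]eq_bigr do rewrite mulrDr.
  by rewrite big_split/= -mulr_suml sum_weight// mul1r.
under [RHS]eq_integral do rewrite PnD.
rewrite (integral_iter_shift n inv (h := fun x => (iter n (transfer g) (fun y => f y + B)%R x)%:E)).
- by rewrite ge0_integral_iter_transfer// => x; exact: ltW.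
- by apply: measurable_EFin_continuous; exact: cLf.
- move=> x; rewrite lee_fin iter_transferE sumr_ge0// => w _.
  by rewrite mulr_ge0// weight_ge0.
Qed.

End G_measures.

(** * Comparison of two G-measures on Borel sets *)

Section uniqueness.
Set Implicit Arguments. Unset Strict Implicit.
Local Open Scope ereal_scope.
Variables (R : realType) (S : finPointedType).
Implicit Types (x y : seqspace S) (mu nu : probability (seqspace S) R).

Lemma integral_ge_cst nu (h : seqspace S -> R) (a : R) : continuous h ->
  (forall x, a <= h x)%R -> a%:E <= \int[nu]_x (h x)%:E.
Proof.
move=> ch ah; have -> : a%:E = \int[nu]_x (cst a%:E) x.
  by rewrite integral_cst// -[LHS]mule1; congr (_ * _); exact/esym/probability_setT.
apply: le_integral => //.
- by apply: integrable_continuous; exact: cst_continuous.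
- exact: integrable_continuous.
- by move=> x _; rewrite lee_fin.
Qed.

Lemma integral_le_cst nu (h : seqspace S -> R) (a : R) : continuous h ->
  (forall x, h x <= a)%R -> \int[nu]_x (h x)%:E <= a%:E.
Proof.
move=> ch ah; have -> : a%:E = \int[nu]_x (cst a%:E) x.
  by rewrite integral_cst// -[LHS]mule1; congr (_ * _); exact/esym/probability_setT.
apply: le_integral => //.
- exact: integrable_continuous.
- by apply: integrable_continuous; exact: cst_continuous.
- by move=> x _; rewrite lee_fin.
Qed.

(** Both integrals equal those of [Pn g n f], whose values lie within [e / 2] of one constant.
    Exchanging the measures gives equality. *)
Lemma Kg_le_integral (g : seqspace S -> R) nu nu' (f : seqspace S -> R) :
  continuous g -> continuous f ->
  (forall e : R, (0 < e)%R -> exists n, forall x y,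
     (`|iter n (transfer g) f x - iter n (transfer g) f y| <= e)%R) ->
  Kg g nu -> Kg g nu' -> \int[nu]_x (f x)%:E <= \int[nu']_x (f x)%:E.
Proof.
move=> cg cf osc Knu Knu'; apply/lee_addgt0Pr => e e0.
have e20 : (0 < e / 2)%R by rewrite divr_gt0.
have [n hn] := osc _ e20.
have cP : continuous (Pn g n f).
  move=> x; apply: (@continuous_comp (seqspace S) (seqspace S) R); first exact: continuous_iter_shift.
  exact: continuous_iter_transfer.
have PE rho : Kg g rho -> \int[rho]_x (f x)%:E = \int[rho]_x (Pn g n f x)%:E.
  (* The case n = 0 is outside the range of [Kg], but there [Pn] is the identity. *)
  by move=> K; case: n {hn cP} => [//|n]; exact: K.
rewrite !PE//; pose c := iter n (transfer g) f point.
apply: (@le_trans _ _ (c + e / 2)%:E).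
  apply: integral_le_cst => // x; rewrite -lerBlDl.
  exact: le_trans (ler_norm _) (hn _ _).
have -> : (c + e / 2 = c - e / 2 + e)%R by lra.
rewrite EFinD leeD2r//; apply: integral_ge_cst => // x.
rewrite lerBlDl -lerBlDr; exact: le_trans (ler_norm _) (hn _ _).
Qed.

(** Open sets form a generating class stable under intersection. An open [U] is the increasing union
    of the sets [F n] of points whose n-cylinder lies in [U], and these have continuous
    indicators. *)
Lemma measure_eq_integral_continuous nu mu :
  (forall f : seqspace S -> R, continuous f ->
     \int[nu]_x (f x)%:E = \int[mu]_x (f x)%:E) -> measure_eq nu mu.
Proof.
move=> numu.
have numu_open (U : set (seqspace S)) : open U -> nu U = mu U.
  move=> oU; pose F n := [set x | forall y, agree n x y -> U y].
  have FU : \bigcup_n F n = U.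
    apply/seteqP; split => [x [n _]|x Ux]; first by apply.
    have /nbhs_agreeP[n hn] : nbhs x U by apply: open_nbhs_nbhs; split.
    by exists n.
  have F_agree n x y : agree n x y -> F n x -> F n y.
    by move=> xy Fx z yz; apply: Fx => i ni; rewrite xy// yz.
  have oF n : open (F n).
    rewrite openE => x Fx; apply/nbhs_agreeP; exists n => y xy.
    exact: F_agree xy Fx.
  have cF n : continuous (\1_(F n) : seqspace S -> R).
    apply/continuous_agreeP => x A /nbhs_singleton nA; exists n => y xy.
    have -> : \1_(F n) y = \1_(F n) x :> R.
      rewrite !indicE; congr (_%:R); congr nat_of_bool.
      apply/idP/idP => /set_mem h; apply/mem_set; last exact: F_agree xy h.
      by apply: F_agree h => i ni; rewrite xy.
    exact: nA.
  have mF n : measurable (F n) by exact: measurable_open.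
  have ndF : {homo F : n m / (n <= m)%N >-> (n <= m)%O}.
    move=> n m nm; apply/subsetPset => x Fx y xy.
    by apply: Fx; exact: agreeS xy.
  have numuF n : nu (F n) = mu (F n).
    by have := numu _ (cF n); rewrite !integral_indic// !setIT.
  have mUF : measurable (\bigcup_n F n) by rewrite FU; exact: measurable_open.
  have nuU := nondecreasing_cvg_mu (mu := nu) mF mUF ndF.
  have muU := nondecreasing_cvg_mu (mu := mu) mF mUF ndF.
  have nuFE : nu \o F = mu \o F by apply/funext.
  by rewrite nuFE in nuU; rewrite -FU; exact: cvg_unique nuU muU.
move=> B mB.
apply: (measure_unique (@open (seqspace S)) (fun=> setT)) => //.
- exact: openI.
- by move=> _; exact: openT.
- by rewrite bigcup_const.
- by move=> _; apply: (@le_lt_trans _ _ 1); [exact: probability_le1|exact: ltry].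
Qed.

Lemma le_var n (g : seqspace S -> R) x y : agree n x y -> `|g x - g y|%:E <= var n g.
Proof. by move=> xy; apply: ereal_sup_ubound; exists (x, y). Qed.

Lemma var_fin_num n (g : seqspace S -> R) :
  (forall x, 0 <= g x <= 1)%R -> var n g \is a fin_num.
Proof.
move=> g01; rewrite fin_numE; apply/andP; split.
  rewrite -ltNye; apply: (@lt_le_trans _ _ 0); first exact: ltNy0.
  have := @le_var n g point point; rewrite subrr normr0; exact.
rewrite -ltey; apply: (@le_lt_trans _ _ 1); last exact: ltry.
apply: ge_ereal_sup => _ [[x y] _ <-]; rewrite lee_fin /=.
by have := g01 x; have := g01 y; rewrite ler_norml; lra.
Qed.

(** Turns the extended-real series into the bound on real partial sums used for contraction; the
    series starts at 1, hence the index [i.+1]. *)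
Lemma sum_sqr_variation_bound (g : seqspace S -> R) :
  (forall x, 0 <= g x <= 1)%R -> sum_sqr_variation g < +oo ->
  exists M : R, forall n, (\sum_(0 <= i < n) fine (var i.+1 g) ^+ 2 <= M)%R.
Proof.
move=> g01; rewrite /sum_sqr_variation.
set T := (X in X < _) => Too.
have T_ge n : \sum_(1 <= i < n) var i g ^+ 2 <= T.
  by apply: nneseries_lim_ge => i _ _; exact: sqre_ge0.
have var2E i : var i g ^+ 2 = (fine (var i g) ^+ 2)%:E.
  by rewrite EFin_expe fineK// var_fin_num.
exists (fine T) => n.
have : 0 <= T by apply: le_trans (T_ge 0%N); rewrite big_geq.
case: T Too T_ge => [r _ T_ge _||//]; last by rewrite ltxx.
have := T_ge n.+1; rewrite big_add1 /=.
rewrite (eq_bigr (fun i => (fine (var i.+1 g) ^+ 2)%:E)) => [|i _]; last exact: var2E.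
by rewrite sumEFin lee_fin.
Qed.

End uniqueness.

(* [Kg g = {mu}], measures being compared on Borel sets only: the library's
   measures are functions on all sets, unconstrained off the sigma-algebra. *)
Theorem theorem2p1 (R : realType) (S : finPointedType) (g : seqspace S -> R)
    (hg : g_function g) (gpos : forall x, 0 < g x)
    (hcomp : comparable_upto_const
       (sum_sqr_variation (fun x => ln (g x))) (sum_sqr_variation g))
    (hfin : (sum_sqr_variation g < +oo)%E)
    (mu : probability (seqspace S) R) (hmu : g_measure g mu) :
  Kg g = [set nu : probability (seqspace S) R | measure_eq nu mu].
Proof.
have [cg g01 g_fib] := hg.
have g_sum x : \sum_(s : S) g (scons s x) = 1 by rewrite -fsum_shift_fiber.
have Kmu := g_measure_Kg cg gpos g_sum hmu.
have [M hM] := sum_sqr_variation_bound g01 hfin.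
have var_le k x y : agree k x y -> `|g x - g y| <= fine (var k g).
  by move=> /(le_var g); rewrite -[X in (_ <= X)%E](fineK (var_fin_num k g01)) lee_fin.
have osc f : continuous f -> forall e : R, 0 < e -> exists n, forall x y,
    `|iter n (transfer g) f x - iter n (transfer g) f y| <= e.
  by move=> cf e; apply: (iter_transfer_oscillation gpos g_sum cg var_le hM).
(* Every G-measure has the same integrals of continuous functions as [mu]; conversely, equality on
   Borel sets preserves all integrals, hence the equations of [Kg]. *)
apply/seteqP; split => [nu Knu|nu nu_mu n n1 f cf].
  apply: measure_eq_integral_continuous => f cf.
  by apply/eqP; rewrite eq_le !(Kg_le_integral cg cf (osc _ cf)).
have numu_int (h : seqspace S -> \bar R) :
    (\int[nu]_x h x = \int[mu]_x h x)%E.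
  by apply: eq_measure_integral => B mB _; exact: nu_mu.
by rewrite !numu_int; exact: Kmu.
Qed.
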